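(* Let $A$ be a finite set with $|A|\ge2$ and let $\mathcal F,\mathcal G\subseteq\mathcal O(A)$ be symmetric conservative clones with $\chi(\mathcal F)=\chi(\mathcal G)$, i.e. $\mathrm r(\mathcal F)=\mathrm r(\mathcal G)$, $\mathrm R(\mathcal F)=\mathrm R(\mathcal G)$, $\mathrm D(\mathcal F)=\mathrm D(\mathcal G)$, and $\Pi(\mathcal F)=\Pi(\mathcal G)$ (in particular $\mathcal F|_{B^{<\omega}}=\mathcal G|_{B^{<\omega}}$ for every $B\in[A]^2$). Then $\mathcal F=\mathcal G$.
   Context: $\mathcal O(A)=\bigcup_{n<\omega}A^{A^n}$; $\mathcal F_{[n]}=\mathcal F\cap A^{A^n}$; $S_A$ is the set of permutations of $A$; $[A]^2$ the 2-element subsets of $A$. A clone with carrier $A$ is a subset of $\mathcal O(A)$ containing all projections and closed under composition. It is conservative if $f(\mathbf a)\in\mathrm{ran}\,\mathbf a$ (the set of entries of $\mathbf a$) for all members $f$ and all arguments $\mathbf a$. It is symmetric if for every member $f$ and $\sigma\in S_A$ the function $f_\sigma(\mathbf a)=\sigma^{-1}(f(\sigma(\mathbf a)))$ (σ applied componentwise) is also a member. $\mathrm r(\mathcal F)$ is the least $r$ such that $\mathcal F$ contains a non-projection $r$-ary function ($\omega$ if none). $\mathrm R_n(\mathcal F)$ is the binary relation on $A^n$: $\mathbf a\,\mathrm R_n(\mathcal F)\,\mathbf b$ iff there is $\sigma\in S_A$ with $f(\mathbf b)=\sigma(f(\mathbf a))$ for all $f\in\mathcal F_{[n]}$; $\mathrm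 D_n(\mathcal F)$ is the binary relation on $A^n$: $\mathbf a\,\mathrm D_n(\mathcal F)\,\mathbf b$ iff there are $a,b\in A$ with $f(\mathbf a)=a$ or $f(\mathbf b)=b$ for every $f\in\mathcal F_{[n]}$; $\mathrm R(\mathcal F)=\bigcup_n\mathrm R_n(\mathcal F)$, $\mathrm D(\mathcal F)=\bigcup_n\mathrm D_n(\mathcal F)$. For $B\subseteq A$, $\mathcal F|_{B^{<\omega}}=\{f|_{B^n}: n<\omega, f\in\mathcal F_{[n]}\}$, a clone with carrier $B$. $\Pi(\mathcal F)$ is a family, indexed by $B\in[A]^2$, of natural isomorphisms $(\sigma_B,\tau_B)$ from $\mathcal F|_{B^{<\omega}}$ onto a fixed representative Post class (clone on $\{0,1\}$), where $\sigma_B\colon B\to\{0,1\}$ is a bijection and $\tau_B$ a bijection of clones preserving arity with $\sigma_B(f(\mathbf a))=\tau_B(f)(\sigma_B(\mathbf a))$; equality $\Pi(\mathcal F)=\Pi(\mathcal G)$ means the families coincide, so the domains $\mathcal F|_{B^{<\omega}}$ and $\mathcal G|_{B^{<\omega}}$ coincide. $\chi(\mathcal F)=(\mathrm r(\mathcal F),\mathrm R(\mathcal F),\mathrm D(\mathcal F),\Pi(\mathcal F))$. *)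

(* Defs.v *)
From HB Require Import structures.
From mathcomp Require Import all_boot all_fingroup.
Set Implicit Arguments. Unset Strict Implicit. Unset Printing Implicit Defensive.

Definition tup (A : finType) (n : nat) := {ffun 'I_n -> A}.
Definition op (A : finType) (n : nat) := {ffun tup A n -> A}.

Definition opset (A : finType) := forall n : nat, {set op A n}.

Definition proj (A : finType) (n : nat) (i : 'I_n) : op A n := [ffun a : tup A n => a i].

Definition comp (A : finType) (n m : nat) (f : op A n) (gs : 'I_n -> op A m) : op A m :=
  [ffun a : tup A m => f [ffun i => gs i a]].

Definition is_clone (A : finType) (F : opset A) : Prop :=
  (forall n (i : 'I_n), proj A i \in F n) /\
  (forall n m (f : op A n) (gs : 'I_n -> op A m),
      f \in F n -> (forall i, gs i \in F m) -> comp f gs \in F m).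

Definition conservative_ops (A : finType) (F : opset A) : Prop :=
  forall n (f : op A n) (a : tup A n), f \in F n -> f a \in codom a.

Definition conj_op (A : finType) (n : nat) (s : {perm A}) (f : op A n) : op A n :=
  [ffun a : tup A n => (s^-1)%g (f [ffun i => s (a i)])].

Definition symmetric_ops (A : finType) (F : opset A) : Prop :=
  forall n (f : op A n) (s : {perm A}), f \in F n -> conj_op s f \in F n.

Definition has_nonproj (A : finType) (F : opset A) (n : nat) : bool :=
  [exists f in F n, [forall i : 'I_n, f != proj A i]].

(* r(F) = r, where None stands for omega *)
Definition rank_is (A : finType) (F : opset A) (r : option nat) : Prop :=
  match r with
  | Some r => has_nonproj F r /\ (forall k, k < r -> ~~ has_nonproj F k)
  | None => forall k, ~~ has_nonproj F k
  end.

Definition Rrel (A : finType) (F : opset A) (n : nat) (a b : tup A n) : bool :=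
  [exists s : {perm A}, [forall f in F n, f b == s (f a)]].

Definition Drel (A : finType) (F : opset A) (n : nat) (a b : tup A n) : bool :=
  [exists x : A, [exists y : A, [forall f in F n, (f a == x) || (f b == y)]]].

Definition agree_on (A : finType) (B : {set A}) (n : nat) (f g : op A n) : Prop :=
  forall a : tup A n, (forall i, a i \in B) -> f a = g a.

Definition same_restriction (A : finType) (F G : opset A) (B : {set A}) : Prop :=
  forall n,
    (forall f, f \in F n -> exists2 g, g \in G n & agree_on B f g) /\
    (forall g, g \in G n -> exists2 f, f \in F n & agree_on B f g).

(* Main.v *)
Require Import Defs.
From HB Require Import structures.
From mathcomp Require Import all_boot all_fingroup.

(* It is enough to show that h in F_n lies in G_n. Let r be the common rank.
   If r = 2 and some binary member of G commutes on a pair, or if r = 3 and G has a majority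
   operation, then G has a majority operation, so (Baker-Pixley) G_n is determined by its
   projections {(f a, f b) | f in G_n}. By majority and symmetry each of these is the graph of a
   bijection, a cross {x} x ran b U ran a x {y}, or the full product ran a x ran b; the relations
   R and D tell these cases apart.
   Otherwise G has a k-ary operation (k = 3 if r = 2, and k = r if r >= 3) that is a projection on
   all tuples with a repeated entry without being a projection. It plays the part of the majority
   operation on the tuples with at least k values, where crosses are impossible, so h lies in G_n
   as soon as some member of G_n agrees with h on all tuples with fewer than k values; such a
   member is provided by the restrictions to the two-element sets and by R. *)

Set Implicit Arguments. Unset Strict Implicit. Unset Printing Implicit Defensive.

(** * Extension of partial bijections, and interpolation from two-point corrections *)

Lemma exists_perm_extending (T : finType) (I : eqType) (s : seq I) (x y : I -> T) :
  {in s &, forall i j, (x i == x j) = (y i == y j)} ->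
  exists p : {perm T}, {in s, forall i, p (x i) = y i}.
Proof.
elim: s => [|i s IHs] eqxy; first by exists 1%g.
have [|p pP] := IHs.
  by move=> j k js ks; apply: eqxy; rewrite inE ?js ?ks orbT.
(* The transposition, applied after [p], corrects the value at [x i] and moves no earlier [y j]
   unless [x j = x i]. *)
exists (p * tperm (p (x i)) (y i))%g => j; rewrite inE permM => /predU1P[->|js].
  by rewrite tpermL.
have eqij: (x i == x j) = (y i == y j).
  by apply: eqxy; rewrite inE ?eqxx // js orbT.
have [xij|xij] := eqVneq (x i) (x j).
  by rewrite -xij tpermL; apply/eqP; rewrite -eqij xij.
rewrite (pP j js) tpermD //; last by rewrite -eqij.
by rewrite -(pP j js) (inj_eq perm_inj).
Qed.

(* [ag f i] reads "f agrees with a fixed target at the position i". *)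
Lemma interpolation (T : Type) (I : eqType) (K : T -> Prop) (ag : T -> I -> bool)
    (s : seq I) :
  (exists f, K f) -> (forall i, exists2 f, K f & ag f i) ->
  (forall f g i j, K f -> K g -> ag f j -> ag g i ->
     exists2 h, K h & [/\ ag h i, ag h j & forall l, ag f l -> ag g l -> ag h l]) ->
  exists2 f, K f & all (ag f) s.
Proof.
move=> [f0 Kf0] K1 K2; have [n] := ubnP (size s); elim: n s => // n IHn [|i [|j s]] /=.
- by move=> _; exists f0.
- by move=> _; have [f Kf fi] := K1 i; exists f; rewrite ?fi.
rewrite !ltnS => sn.
(* [f] handles every position but [i], [g] every position but [j]; the two-point hypothesis repairs
   both positions and keeps what [f] and [g] share. *)
have [f Kf /= /andP[fj fs]] := IHn (j :: s) sn.
have [g Kg /= /andP[gi gs]] := IHn (i :: s) sn.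
have [h Kh [hi hj hl]] := K2 f g i j Kf Kg fj gi.
exists h => //; rewrite hi hj /=; apply/allP => l ls.
by apply: hl; [apply: (allP fs)|apply: (allP gs)].
Qed.

(** * Pairs, triples and special operations *)

Definition t2 (A : finType) (x y : A) : tup A 2 := [ffun i => tnth [tuple x; y] i].
Definition t3 (A : finType) (x y z : A) : tup A 3 := [ffun i => tnth [tuple x; y; z] i].

Definition is_majority (A : finType) (m : op A 3) : Prop :=
  forall x y, [/\ m (t3 x x y) = x, m (t3 x y x) = x & m (t3 y x x) = x].

Definition is_proper_semiprojection (A : finType) (k : nat) (i : 'I_k) (s : op A k) : Prop :=
  (forall (a : tup A k) p q, p != q -> a p = a q -> s a = a i) /\ exists a, s a <> a i.

(** For conservative operations: each binary member is a projection on every two-element set,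
    possibly a different one on different sets. *)
Definition binary_ops_locally_trivial (A : finType) (F : opset A) : Prop :=
  forall f x y, f \in F 2 -> x != y -> f (t2 x y) <> f (t2 y x).

Definition small_ops_trivial (A : finType) (F : opset A) (r : nat) : Prop :=
  forall k (f : op A k), k < r -> f \in F k -> exists i, f = proj A i.

Section Tuples.
Variable A : finType.

Lemma ord2E (i : 'I_2) : i = ord0 \/ i = ord_max.
Proof. by case: i => [[|[|//]] ?]; [left|right]; apply: val_inj. Qed.

Lemma ord3E (i : 'I_3) : [\/ i = ord0, i = inord 1 | i = ord_max].
Proof.
case: i => [[|[|[|//]]] ?]; [apply: Or31|apply: Or32|apply: Or33];
  by apply: val_inj; rewrite /= ?inordK.
Qed.

Lemma t3_0 (x y z : A) : t3 x y z ord0 = x.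
Proof. by rewrite ffunE (tnth_nth x). Qed.
Lemma t3_1 (x y z : A) : t3 x y z (inord 1) = y.
Proof. by rewrite ffunE (tnth_nth x) /= inordK. Qed.
Lemma t3_2 (x y z : A) : t3 x y z ord_max = z.
Proof. by rewrite ffunE (tnth_nth x). Qed.
Lemma t2_0 (x y : A) : t2 x y ord0 = x.
Proof. by rewrite ffunE (tnth_nth x). Qed.
Lemma t2_1 (x y : A) : t2 x y ord_max = y.
Proof. by rewrite ffunE (tnth_nth x). Qed.

Lemma t3P (a : tup A 3) x y z :
  a ord0 = x -> a (inord 1) = y -> a ord_max = z -> a = t3 x y z.
Proof.
by move=> a0 a1 a2; apply/ffunP => i; have [->|->|->] := ord3E i;
  rewrite ?t3_0 ?t3_1 ?t3_2.
Qed.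

Lemma t2P (a : tup A 2) x y : a ord0 = x -> a ord_max = y -> a = t2 x y.
Proof.
by move=> a0 a1; apply/ffunP => i; have [->|->] := ord2E i; rewrite ?t2_0 ?t2_1.
Qed.

Lemma repeated_entry3 (a : tup A 3) p q : p != q -> a p = a q ->
  exists x y, [\/ a = t3 x x y, a = t3 x y x | a = t3 y x x].
Proof.
have [->|->|->] := ord3E p; have [->|->|->] := ord3E q; rewrite ?eqxx // => _ apq;
  [ exists (a ord0), (a ord_max); apply: Or31 | exists (a ord0), (a (inord 1)); apply: Or32
  | exists (a ord0), (a ord_max); apply: Or31 | exists (a ord_max), (a ord0); apply: Or33
  | exists (a ord0), (a (inord 1)); apply: Or32 | exists (a ord_max), (a ord0); apply: Or33];
  exact: t3P.
Qed.

End Tuples.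

(** * Closure properties of symmetric conservative clones *)

Section SymmetricConservativeClone.
Variables (A : finType) (F : opset A).
Hypotheses (cloneF : is_clone F) (symF : symmetric_ops F) (consF : conservative_ops F).

Lemma mem_proj n (i : 'I_n) : proj A i \in F n.
Proof. exact: cloneF.1. Qed.

Lemma mem_comp n m (f : op A n) (gs : 'I_n -> op A m) :
  f \in F n -> (forall i, gs i \in F m) ->
  exists2 g, g \in F m & forall a, g a = f [ffun i => gs i a].
Proof.
move=> fF gsF; exists (Defs.comp f gs); first exact: cloneF.2.
by move=> a; rewrite ffunE.
Qed.

Lemma mem_comp2 n (f : op A 2) (g1 g2 : op A n) :
  f \in F 2 -> g1 \in F n -> g2 \in F n ->
  exists2 g, g \in F n & forall a, g a = f (t2 (g1 a) (g2 a)).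
Proof.
move=> fF g1F g2F; have [|g gF gE] := @mem_comp 2 n f (fun i => tnth [tuple g1; g2] i) fF.
  by move=> i; have [->|->] := ord2E i; rewrite (tnth_nth g1).
exists g => // a; rewrite gE; congr (f _).
by apply: t2P; rewrite ffunE (tnth_nth g1).
Qed.

Lemma mem_comp3 n (f : op A 3) (g1 g2 g3 : op A n) :
  f \in F 3 -> g1 \in F n -> g2 \in F n -> g3 \in F n ->
  exists2 g, g \in F n & forall a, g a = f (t3 (g1 a) (g2 a) (g3 a)).
Proof.
move=> fF g1F g2F g3F.
have [|g gF gE] := @mem_comp 3 n f (fun i => tnth [tuple g1; g2; g3] i) fF.
  by move=> i; have [->|->|->] := ord3E i; rewrite (tnth_nth g1) /= ?inordK.
exists g => // a; rewrite gE; congr (f _).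
by apply: t3P; rewrite ffunE (tnth_nth g1) /= ?inordK.
Qed.

Lemma mem_minor n m (f : op A n) (phi : 'I_n -> 'I_m) : f \in F n ->
  exists2 g, g \in F m & forall a, g a = f [ffun i => a (phi i)].
Proof.
move=> fF; have [//|g gF gE] := mem_comp (gs := fun i => proj A (phi i)) fF.
  by move=> i; apply: mem_proj.
by exists g => // a; rewrite gE; congr (f _); apply/ffunP => i; rewrite !ffunE.
Qed.

Lemma mem_minor2 (f : op A 2) : f \in F 2 ->
  exists2 g, g \in F 2 & forall x y, g (t2 x y) = f (t2 y x).
Proof.
move=> fF; have [g gF gE] := mem_minor (fun i => rev_ord i) fF; exists g => // x y.
rewrite gE; congr (f _); apply: t2P; rewrite ffunE.
  by rewrite (_ : rev_ord ord0 = ord_max) ?t2_1 //; apply: val_inj.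
by rewrite (_ : rev_ord ord_max = ord0) ?t2_0 //; apply: val_inj.
Qed.

Lemma mem_conj n (f : op A n) (s : {perm A}) : f \in F n ->
  exists2 g, g \in F n & forall a, s (g a) = f [ffun i => s (a i)].
Proof.
by move=> fF; exists (conj_op s f); [apply: symF|move=> a; rewrite ffunE permKV].
Qed.

Lemma mem_conj2 (f : op A 2) (s : {perm A}) : f \in F 2 ->
  exists2 g, g \in F 2 & forall x y, s (g (t2 x y)) = f (t2 (s x) (s y)).
Proof.
move=> fF; have [g gF gE] := mem_conj s fF; exists g => // x y.
by rewrite gE; congr (f _); apply: t2P; rewrite ffunE ?t2_0 ?t2_1.
Qed.

Lemma mem_conj3 (f : op A 3) (s : {perm A}) : f \in F 3 ->
  exists2 g, g \in F 3 & forall x y z, s (g (t3 x y z)) = f (t3 (s x) (s y) (s z)).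
Proof.
move=> fF; have [g gF gE] := mem_conj s fF; exists g => // x y z.
by rewrite gE; congr (f _); apply: t3P; rewrite ffunE ?t3_0 ?t3_1 ?t3_2.
Qed.

Lemma op_entry n (f : op A n) a : f \in F n -> exists i, f a = a i.
Proof. by move=> /(consF a)/codomP[i ->]; exists i. Qed.

Lemma op2_entry (f : op A 2) x y : f \in F 2 -> f (t2 x y) = x \/ f (t2 x y) = y.
Proof.
move=> fF; have [i ->] := op_entry (t2 x y) fF.
by have [->|->] := ord2E i; rewrite ?t2_0 ?t2_1; [left|right].
Qed.

Lemma op3_entry (f : op A 3) x y z : f \in F 3 ->
  [\/ f (t3 x y z) = x, f (t3 x y z) = y | f (t3 x y z) = z].
Proof.
move=> fF; have [i ->] := op_entry (t3 x y z) fF.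
by have [->|->|->] := ord3E i; rewrite ?t3_0 ?t3_1 ?t3_2; [apply: Or31|apply: Or32|apply: Or33].
Qed.

Lemma op2_idem (f : op A 2) x : f \in F 2 -> f (t2 x x) = x.
Proof. by move=> fF; case: (op2_entry x x fF). Qed.

End SymmetricConservativeClone.

(** * From one commuting pair to a majority operation *)

Section Majority.
Variables (A : finType) (F : opset A).
Hypotheses (cloneF : is_clone F) (symF : symmetric_ops F) (consF : conservative_ops F).

Let opE := fun f x y (fF : f \in F 2) => op2_entry consF x y fF.
Let idem := fun f x (fF : f \in F 2) => op2_idem consF x fF.

(** Any pair of distinct elements is carried to [u, v] by a permutation, so a conjugate commutes on
    it; interpolation collects all pairs in one operation. *)
Lemma ex_commutative_op (f : op A 2) u v :
  f \in F 2 -> u != v -> f (t2 u v) = f (t2 v u) ->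
  exists2 p, p \in F 2 & forall x y, p (t2 x y) = p (t2 y x).
Proof.
move=> fF uv fuv.
pose ag (g : op A 2) (xy : A * A) := g (t2 xy.1 xy.2) == g (t2 xy.2 xy.1).
have [|||p pF pag] := @interpolation _ _ (fun g => g \in F 2) ag (enum {: A * A}).
- by exists f.
- move=> [x y]; rewrite /ag /=; have [->|xy] := eqVneq x y; first by exists f.
  have [|s sP] := @exists_perm_extending A _ [:: true; false]
    (fun b : bool => if b then x else y) (fun b : bool => if b then u else v).
    by do 2![case]; rewrite ?eqxx // => _ _; rewrite ?(negPf xy) ?(negPf uv) // eq_sym (negPf xy)
      eq_sym (negPf uv).
  have [g gF gE] := mem_conj2 symF s fF; exists g => //.
  apply/eqP; apply: (@perm_inj _ s); rewrite !gE.
  by rewrite (sP true) // (sP false).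
- move=> g1 g2 [x y] [x' y'] g1F g2F; rewrite /ag /= => /eqP ag1 /eqP ag2.
  have [g2' g2'F g2'E] := mem_minor2 cloneF g2F.
  (* Here [h] is [g1(g2(x,y), g2(y,x))]. Where [g2] commutes, both arguments coincide; otherwise
     they are [x] and [y] in some order. *)
  have [h hF hE] := mem_comp2 cloneF g1F g2F g2'F.
  have hag z t : g1 (t2 z t) = g1 (t2 t z) \/ g2 (t2 z t) = g2 (t2 t z) ->
      h (t2 z t) = h (t2 t z).
    rewrite !hE !g2'E; case=> [g1zt|->//].
    by case: (opE z t g2F) => ->; case: (opE t z g2F) => ->; rewrite ?idem.
  exists h => //; split; [by apply/eqP/hag; right|by apply/eqP/hag; left|].
  by move=> [z t] /= /eqP ? _; apply/eqP/hag; left.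
exists p => // x y; apply/eqP; apply: (allP pag (x, y)); exact: mem_enum.
Qed.

Section Tournament.
Variable p : op A 2.
Hypotheses (pF : p \in F 2) (pC : forall x y, p (t2 x y) = p (t2 y x)).

(** Read [p (t2 x y)] as the winner of an edge. Conjugation by [s] reverses an edge exactly when [s]
    does not send its winner to the winner of the image edge, so a suitable transposition inside the
    triangle is enough. *)
Lemma ex_reversing_conj_at_vertex u v w : u != v -> u != w ->
  exists2 g, g \in F 2 & [/\ forall x y, g (t2 x y) = g (t2 y x),
    g (t2 u v) != p (t2 u v) & g (t2 u w) != p (t2 u w)].
Proof.
move=> uv uw; suff [s [sv sw]]: exists s : {perm A},
    s (p (t2 u v)) != p (t2 (s u) (s v)) /\ s (p (t2 u w)) != p (t2 (s u) (s w)).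
  have [g gF gE] := mem_conj2 symF s pF; exists g => //; split.
  - by move=> x y; apply: (@perm_inj _ s); rewrite !gE pC.
  - by rewrite -(inj_eq (@perm_inj _ s)) gE eq_sym.
  - by rewrite -(inj_eq (@perm_inj _ s)) gE eq_sym.
have vu : v != u by rewrite eq_sym.
have wu : w != u by rewrite eq_sym.
have [<-|vw] := eqVneq v w.
  exists (tperm u v); rewrite tpermL tpermR (pC v u).
  by case: (opE u v pF) => ->; rewrite ?tpermL ?tpermR.
have wv : w != v by rewrite eq_sym.
(* If [u] wins one edge and loses the other, swap [v] and [w]. If [u] wins both, swap it with the
   vertex losing both its edges in the triangle; if it loses both, with the vertex winning both. *)
case: (opE u v pF) => puv; case: (opE u w pF) => puw.
- case: (opE v w pF) => pvw.
    exists (tperm u w); rewrite puv puw tpermL tpermR tpermD //.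
    by rewrite -[p (t2 w v)]pC pvw -[p (t2 w u)]pC puw.
  exists (tperm u v); rewrite puv puw tpermL tpermR tpermD //.
  by rewrite pvw -[p (t2 v u)]pC puv.
- exists (tperm v w); rewrite puv puw tpermL tpermR tpermD //.
  by rewrite puv puw.
- exists (tperm v w); rewrite puv puw tpermL tpermR tpermD //.
  by rewrite puv puw.
- case: (opE v w pF) => pvw.
    exists (tperm u v); rewrite puv puw tpermL tpermR tpermD //.
    by rewrite pvw -[p (t2 v u)]pC puv.
  exists (tperm u w); rewrite puv puw tpermL tpermR tpermD //.
  by rewrite -[p (t2 w v)]pC pvw -[p (t2 w u)]pC puw.
Qed.

Lemma ex_reversing_conj x y x' y' : x != y -> x' != y' ->
  exists2 g, g \in F 2 & [/\ forall z t, g (t2 z t) = g (t2 t z),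
    g (t2 x y) != p (t2 x y) & g (t2 x' y') != p (t2 x' y')].
Proof.
move=> xy xy'.
have [xx|xx] := eqVneq x x'; first by rewrite -xx in xy' *; apply: ex_reversing_conj_at_vertex.
have [xy1|xy1] := eqVneq x y'.
  rewrite -xy1 in xy' *; rewrite eq_sym in xy'.
  have [g gF [gC g1 g2]] := ex_reversing_conj_at_vertex xy xy'.
  by exists g => //; split=> //; rewrite gC pC.
have [yx|yx] := eqVneq y x'.
  rewrite -yx in xy' *; rewrite eq_sym in xy.
  have [g gF [gC g1 g2]] := ex_reversing_conj_at_vertex xy xy'.
  by exists g => //; split=> //; rewrite gC pC.
have [yy|yy] := eqVneq y y'.
  rewrite -yy in xy' *; rewrite eq_sym in xy; rewrite eq_sym in xy'.
  have [g gF [gC g1 g2]] := ex_reversing_conj_at_vertex xy xy'.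
  by exists g => //; split=> //; rewrite gC pC.
(* For disjoint edges, flipping both at once reverses both. *)
pose s := (tperm x y * tperm x' y')%g.
have sx : s x = y by rewrite permM tpermL tpermD // eq_sym.
have sy : s y = x by rewrite permM tpermR tpermD // eq_sym.
have sx' : s x' = y' by rewrite permM (tpermD xx yx) tpermL.
have sy' : s y' = x' by rewrite permM (tpermD xy1 yy) tpermR.
have [g gF gE] := mem_conj2 symF s pF; exists g => //; split.
- by move=> z t; apply: (@perm_inj _ s); rewrite !gE pC.
- rewrite -(inj_eq (@perm_inj _ s)) gE sx sy -pC.
  by case: (opE x y pF) => ->; rewrite ?sx ?sy // eq_sym.
- rewrite -(inj_eq (@perm_inj _ s)) gE sx' sy' -pC.
  by case: (opE x' y' pF) => ->; rewrite ?sx' ?sy' // eq_sym.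
Qed.

(* The commutative operations of [F] are tournaments on [A]; they are closed under taking
   the majority orientation edge by edge, so it is enough to reverse two edges at a time. *)
Lemma ex_reversed_op : exists2 q, q \in F 2 &
  forall x y, q (t2 x y) = q (t2 y x) /\ (x != y -> q (t2 x y) != p (t2 x y)).
Proof.
pose K (g : op A 2) := g \in F 2 /\ forall x y, g (t2 x y) = g (t2 y x).
pose ag (g : op A 2) (xy : A * A) := (xy.1 == xy.2) || (g (t2 xy.1 xy.2) != p (t2 xy.1 xy.2)).
have Kpair i j : exists2 g, K g & ag g i && ag g j.
  case: i j => [x y] [x' y']; rewrite /ag /=.
  have [<-|xy] := eqVneq x y; have [<-|xy'] := eqVneq x' y'.
  - by exists p.
  - by have [g gF [gC g1 g2]] := ex_reversing_conj xy' xy'; exists g.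
  - by have [g gF [gC g1 g2]] := ex_reversing_conj xy xy; exists g; rewrite ?g1.
  - by have [g gF [gC g1 g2]] := ex_reversing_conj xy xy'; exists g; rewrite ?g1 ?g2.
have [|||q [qF qC] qag] := @interpolation _ _ K ag (enum {: A * A}).
- by exists p.
- by move=> i; have [g Kg /andP[]] := Kpair i i; exists g.
- move=> g1 g2 i j [g1F g1C] [g2F g2C] ag1 ag2.
  have [g3 [g3F g3C] /andP[ag3i ag3j]] := Kpair i j.
  (* [N] is [g2(x, g1(x,y))]. Where [g1] and [g2] agree, [N(x,y)] and [N(y,x)] both equal the common
     value; elsewhere they are [x] and [y], and [g3] breaks the tie. *)
  have [N NF NE] := mem_comp2 cloneF g2F (mem_proj cloneF ord0) g1F.
  have [N' N'F N'E] := mem_minor2 cloneF NF.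
  have [h hF hE] := mem_comp2 cloneF g3F NF N'F.
  have hE' x y : h (t2 x y) = if g1 (t2 x y) == g2 (t2 x y) then g1 (t2 x y) else g3 (t2 x y).
    rewrite hE N'E !NE !ffunE !(tnth_nth x) /= -(g1C x y).
    case: (opE x y g1F) => g1E; case: (opE x y g2F) => g2E; rewrite g1E g2E ?eqxx.
    + by rewrite ?idem // -g2C g2E ?idem.
    + by rewrite idem // -g2C g2E; case: eqP => // <-; rewrite ?idem.
    + by rewrite ?idem //; case: eqP => // <-; rewrite ?idem.
    + by rewrite ?idem.
  have agE x y g g' : (ag g (x, y)) -> ag g' (x, y) -> K g -> K g' -> x != y ->
      g (t2 x y) = g' (t2 x y).
    rewrite /ag /= => agg agg' [gF _] [g'F _] xy; move: agg agg'; rewrite (negPf xy) /=.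
    by case: (opE x y gF) => ->; case: (opE x y g'F) => ->;
      case: (opE x y pF) => ->; rewrite ?eqxx.
  exists h; first by split=> // x y; rewrite !hE' g1C g2C g3C.
  split.
  + case: i {ag1 ag3j Kpair} ag2 ag3i => x y ag2 ag3.
    have [xy|xy] := boolP (x == y); first by rewrite /ag /= xy.
    rewrite /ag /= hE'; case: (g1 _ =P g2 _) => [->|_]; last exact: ag3.
    exact: ag2.
  + case: j {ag2 ag3i Kpair} ag1 ag3j => x y ag1 ag3.
    have [xy|xy] := boolP (x == y); first by rewrite /ag /= xy.
    rewrite /ag /= hE'; case: (g1 _ =P g2 _) => _; last exact: ag3.
    exact: ag1.
  + case=> x y agl1 agl2; have [xy|xy] := boolP (x == y); first by rewrite /ag /= xy.
    by rewrite /ag /= hE' (agE x y g1 g2) // eqxx.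
exists q => // x y; split=> // xy.
by have := allP qag (x, y); rewrite mem_enum /ag /= (negPf xy); apply.
Qed.

(** On each pair [p] and [q] are the join and meet of a two-element lattice, so by absorption
    [q(p(q(x,y),z), p(q(x,z),y))] is a majority operation. *)
Lemma ex_majority_of_tournament : exists2 m, m \in F 3 & is_majority m.
Proof.
have [q qF qP] := ex_reversed_op.
have [P0 P1 P2] : [/\ proj A (ord0 : 'I_3) \in F 3, proj A (inord 1 : 'I_3) \in F 3
  & proj A (ord_max : 'I_3) \in F 3] by split; apply: mem_proj.
have [q1 q1F q1E] := mem_comp2 cloneF qF P0 P1.
have [q2 q2F q2E] := mem_comp2 cloneF qF P0 P2.
have [p1 p1F p1E] := mem_comp2 cloneF pF q1F P2.
have [p2 p2F p2E] := mem_comp2 cloneF pF q2F P1.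
have [m mF mE] := mem_comp2 cloneF qF p1F p2F; exists m => // x y.
have pI z : p (t2 z z) = z by apply: idem.
have qI z : q (t2 z z) = z by apply: idem.
rewrite !mE !p1E !p2E !q1E !q2E !(ffunE _ (t3 _ _ _)) !(t3_0, t3_1, t3_2).
have [->|xy] := eqVneq x y; first by rewrite !(pI, qI).
have [qC /(_ xy) qp] := qP x y; have pC' := pC x y.
by case: (opE x y pF) qp => pE; case: (opE x y qF) => qE; rewrite pE qE ?eqxx // => _;
  rewrite pE in pC'; rewrite qE in qC; rewrite !(pE, qE, pI, qI, =^~ pC', =^~ qC).
Qed.

End Tournament.

Lemma ex_majority_of_commuting_pair (f : op A 2) u v :
  f \in F 2 -> u != v -> f (t2 u v) = f (t2 v u) ->
  exists2 m, m \in F 3 & is_majority m.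
Proof.
move=> fF uv fuv; have [p pF pC] := ex_commutative_op fF uv fuv.
exact: ex_majority_of_tournament pF pC.
Qed.

End Majority.

(** * Shapes of the binary projections: graph, cross or full product *)

Section BinaryProjections.
Variables (A : finType) (F : opset A).
Hypotheses (cloneF : is_clone F) (symF : symmetric_ops F) (consF : conservative_ops F).

(** What majority operations and semiprojections have in common: a combination of [f1], [f2], [f3]
    follows [f2] at [b] and still returns every common value of [f1] and [f3]. *)
Definition third_value_property n (b : tup A n) : Prop :=
  forall f1 f2 f3, f1 \in F n -> f2 \in F n -> f3 \in F n ->
    f1 b != f2 b -> f1 b != f3 b -> f2 b != f3 b ->
    exists2 f, f \in F n & f b = f2 b /\ forall a, f1 a = f3 a -> f a = f1 a.

Definition attained n (a b : tup A n) (x y : A) : bool :=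
  [exists f in F n, (f a == x) && (f b == y)].

Lemma attainedP n (a b : tup A n) x y :
  reflect (exists2 f, f \in F n & f a = x /\ f b = y) (attained a b x y).
Proof.
apply: (iffP exists_inP) => [[f fF /andP[/eqP fa /eqP fb]]|[f fF [fa fb]]];
  by exists f; rewrite ?fa ?fb ?eqxx.
Qed.

Lemma attainedC n (a b : tup A n) x y : attained a b x y = attained b a y x.
Proof. by apply: eq_existsb => f; rewrite [(f a == _) && _]andbC. Qed.

Lemma attained_proj n (a b : tup A n) i : attained a b (a i) (b i).
Proof.
by apply/attainedP; exists (proj A i); [apply: mem_proj|rewrite !ffunE].
Qed.

(** Put a projection in the middle between two members that meet the row in different points: the
    third-value property keeps the value at [a] and takes the projection's value at [b]. *)
Lemma attained_row n (a b : tup A n) x y1 y2 i : third_value_property b ->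
  attained a b x y1 -> attained a b x y2 -> y1 != y2 -> attained a b x (b i).
Proof.
move=> tvb /attainedP[g1 g1F [g1a g1b]] /attainedP[g2 g2F [g2a g2b]] y12.
have [->|yi1] := eqVneq (b i) y1; first by apply/attainedP; exists g1.
have [->|yi2] := eqVneq (b i) y2; first by apply/attainedP; exists g2.
have [||||f fF [fb fa]] := tvb g1 (proj A i) g2 g1F _ g2F; rewrite ?ffunE ?g1b ?g2b //.
- exact: mem_proj.
- by rewrite eq_sym.
- by apply/attainedP; exists f => //; rewrite fa ?g1a ?g2a // fb ffunE.
Qed.

(** The last two clauses put a coordinate on each arm off the centre, which excludes degenerate
    crosses. *)
Definition cross_at n (a b : tup A n) x y : Prop :=
  [/\ forall i, attained a b x (b i), forall i, attained a b (a i) y,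
      forall f, f \in F n -> f a = x \/ f b = y,
      exists2 w, a w != x & b w = y & exists2 v, a v = x & b v != y].

Lemma full_or_cross_of_row n (a b : tup A n) f g :
  third_value_property a -> third_value_property b ->
  f \in F n -> g \in F n -> f a = g a -> f b != g b ->
  (forall i j, attained a b (a i) (b j)) \/ exists x y, cross_at a b x y.
Proof.
move=> tva tvb fF gF fga fgb.
have row i : attained a b (f a) (b i).
  by apply: (attained_row _ tvb _ _ fgb); apply/attainedP; [exists f|exists g].
have [/forallP full|] := boolP [forall i, forall j, attained a b (a i) (b j)].
  by left=> i j; apply: (forallP (full i)).
move=> /forallPn[w /forallPn[v nwv]]; right; exists (f a), (b w).
have wx : a w != f a by apply: contraNneq nwv => ->.
have col i : attained a b (a i) (b w).
  rewrite attainedC; apply: (attained_row _ tva _ _ wx); rewrite attainedC //.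
  exact: attained_proj.
have cross h : h \in F n -> h a = f a \/ h b = b w.
  move=> hF; have [->|ha] := eqVneq (h a) (f a); [by left|right].
  apply/eqP; apply: contraNT nwv => hb.
  have [l hl] := op_entry consF b hF.
  apply: (@attained_row _ _ _ _ (h b) (b w)) => //.
  rewrite attainedC; apply: (attained_row _ tva _ _ ha); rewrite attainedC ?hl //.
  by apply/attainedP; exists h.
have vy : b v != b w by apply: contraNneq nwv => ->; apply: attained_proj.
split=> //; first by exists w.
exists v => //; have [] := cross (proj A v); rewrite ?ffunE //; first exact: mem_proj.
by move=> /eqP; rewrite (negPf vy).
Qed.

Lemma cross_at_sym n (a b : tup A n) x y : cross_at b a y x -> cross_at a b x y.
Proof.
case=> row col cross [w wx wy] [v vx vy]; split.
- by move=> i; rewrite attainedC.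
- by move=> i; rewrite attainedC.
- by move=> f /cross[]; [right|left].
- by exists v.
- by exists w.
Qed.

(** If [a] and [b] identify the same members, the projection is the graph of a partial bijection,
    which extends to a permutation. Otherwise some row or column has two points. *)
Lemma Rrel_full_or_cross n (a b : tup A n) :
  third_value_property a -> third_value_property b ->
  [\/ Rrel F a b, forall i j, attained a b (a i) (b j) | exists x y, cross_at a b x y].
Proof.
move=> tva tvb.
have [inj|] := boolP [forall f in F n, forall g in F n, (f a == g a) == (f b == g b)].
  have [|s sP] := @exists_perm_extending A _ (enum (F n)) (fun f => f a) (fun f => f b).
    move=> f g; rewrite !mem_enum => fF gF.
    by have /forall_inP/(_ g gF)/eqP := forall_inP inj f fF.
  apply: Or31; apply/existsP; exists s; apply/forall_inP => f fF.
  by rewrite sP // mem_enum.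
move=> /forall_inPn[f fF /forall_inPn[g gF]].
have [fga|fga] := eqVneq (f a) (g a); have [fgb|fgb] := eqVneq (f b) (g b) => // _.
  by case: (full_or_cross_of_row tva tvb fF gF fga fgb); [apply: Or32|apply: Or33].
case: (full_or_cross_of_row tvb tva fF gF fgb fga) => [full|[y [x xy]]].
  by apply: Or32 => i j; rewrite attainedC.
by apply: Or33; exists x, y; apply: cross_at_sym.
Qed.

(* A permutation mapping [(x, x')] to [(y', y)] carries the implication to its own iterates,
   and these close up into a cycle. *)
Lemma implication_reversal x x' y y' : x != x' -> y != y' ->
  (forall f, f \in F 2 -> f (t2 x x') = x' -> f (t2 y' y) = y) ->
  forall f, f \in F 2 -> f (t2 y' y) = y -> f (t2 x x') = x'.
Proof.
move=> xx yy imp.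
have [|s sP] := @exists_perm_extending A _ [:: true; false]
    (fun b : bool => if b then x else x') (fun b : bool => if b then y' else y).
  by do 2![case]; rewrite ?eqxx // => _ _; rewrite ?(negPf xx) ?(negPf yy) // eq_sym
    ?(negPf xx) ?(negPf yy) // eq_sym (negPf yy).
have sx : s x = y' by rewrite (sP true).
have sx' : s x' = y by rewrite (sP false).
have iter m f : f \in F 2 -> f (t2 x x') = x' ->
    f (t2 ((s ^+ m)%g x) ((s ^+ m)%g x')) = (s ^+ m)%g x'.
  elim: m f => [|m IHm] f fF fx; first by rewrite expg0 !perm1.
  have [g gF gE] := mem_conj2 symF (s ^+ m)%g fF.
  rewrite expgS !permM sx sx' -gE; congr (_ _); apply: imp => //.
  by apply: (@perm_inj _ (s ^+ m)%g); rewrite gE; apply: IHm.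
move=> f fF fy; have [g gF gE] := mem_conj2 symF s fF.
have gx : g (t2 x x') = x' by apply: (@perm_inj _ s); rewrite gE sx sx'.
(* One application of [s] after [#[s] - 1] iterations returns to [x, x']. *)
have := congr1 s (iter #[s]%g.-1 g gF gx).
by rewrite gE -!permM -expgSr prednK ?order_gt0 // expg_order !perm1.
Qed.

(** On [a] and [b] members act through binary minors. If [(x', y')] were missing, an implication
    between the two pairs would hold; its reversal contradicts the point [(x, y)]. *)
Lemma two_valued_graph n (a b : tup A n) x x' y y' w v :
  x != x' -> y != y' -> a v = x -> b v = y' -> a w = x' -> b w = y ->
  (forall i, a i = x /\ b i = y' \/ a i = x' /\ b i = y) ->
  attained a b x y -> attained a b x' y'.
Proof.
move=> xx yy avx bvy awx bwy ab /attainedP[f fF [fa fb]].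
have [f' f'F f'E] := mem_minor cloneF (fun i => if a i == x then ord0 else ord_max : 'I_2) fF.
have f'a : f' (t2 x x') = x.
  rewrite f'E; apply: etrans fa; congr (f _); apply/ffunP => i; rewrite ffunE.
  by case: (ab i) => [[-> _]|[-> _]]; rewrite ?eqxx ?t2_0 // eq_sym (negPf xx) t2_1.
have f'b : f' (t2 y' y) = y.
  rewrite f'E; apply: etrans fb; congr (f _); apply/ffunP => i; rewrite ffunE.
  by case: (ab i) => [[-> ->]|[-> ->]]; rewrite ?eqxx ?t2_0 // eq_sym (negPf xx) t2_1.
apply: contraT => natt; case/eqP: (xx); rewrite -[LHS]f'a.
apply: (implication_reversal xx yy) => // e eF ex.
have [g gF gE] := mem_comp2 cloneF eF (mem_proj cloneF v) (mem_proj cloneF w).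
case: (op2_entry consF y' y eF) => // ey; case/negP: natt; apply/attainedP.
by exists g => //; rewrite !gE !ffunE avx bvy awx bwy.
Qed.

End BinaryProjections.

(** * The inclusion in the presence of a majority operation *)

(** At [b] the operation [m] selects one of three distinct values; conjugating by a transposition
    and reordering the arguments makes it select that of [f2]. *)
Lemma majority_third_value (A : finType) (F : opset A) (m : op A 3) n (b : tup A n) :
  is_clone F -> symmetric_ops F -> conservative_ops F ->
  m \in F 3 -> is_majority m -> third_value_property F b.
Proof.
move=> cloneF symF consF mF mP f1 f2 f3 f1F f2F f3F b12 b13 b23.
have conjm (s : {perm A}) : exists2 g, g \in F 3 & is_majority g /\
    forall x y z, s (g (t3 x y z)) = m (t3 (s x) (s y) (s z)).
  have [g gF gE] := mem_conj3 symF s mF; exists g => //; split=> // x y.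
  by have [? ? ?] := mP (s x) (s y); split; apply: (@perm_inj _ s); rewrite gE.
case: (op3_entry consF (f1 b) (f2 b) (f3 b) mF) => mb.
- have [g gF [gP gE]] := conjm (tperm (f1 b) (f2 b)).
  have [f fF fE] := mem_comp3 cloneF gF f2F f1F f3F; exists f => //; split=> [|a a13].
    by apply: (@perm_inj _ (tperm (f1 b) (f2 b))); rewrite fE gE tpermL tpermR tpermD.
  by rewrite fE -a13; have [] := gP (f1 a) (f2 a).
- have [f fF fE] := mem_comp3 cloneF mF f1F f2F f3F; exists f => //; split=> [|a a13].
    by rewrite fE.
  by rewrite fE -a13; have [] := mP (f1 a) (f2 a).
- have [g gF [gP gE]] := conjm (tperm (f2 b) (f3 b)).
  have [f fF fE] := mem_comp3 cloneF gF f1F f3F f2F; exists f => //; split=> [|a a13].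
    apply: (@perm_inj _ (tperm (f2 b) (f3 b))); rewrite fE gE tpermL tpermR tpermD //.
      by rewrite eq_sym.
    by rewrite eq_sym.
  by rewrite fE -a13; have [] := gP (f1 a) (f2 a).
Qed.

(** Interpolation over all tuples yields a member equal to [h]. The index in ['I_n] provides a
    projection to start from. *)
Lemma interpolation_clone (A : finType) (G : opset A) n (h : op A n) :
  is_clone G -> conservative_ops G -> 'I_n ->
  (forall a b f g, f \in G n -> g \in G n -> f b = h b -> g a = h a ->
     exists2 k, k \in G n & [/\ k a = h a, k b = h b &
       forall c, f c = h c -> g c = h c -> k c = h c]) ->
  (forall a, exists2 f, f \in G n & f a = h a) -> h \in G n.
Proof.
move=> cloneG consG i0 step base.
have [|||f fG fh] := @interpolation _ _ (fun f => f \in G n) (fun f a => f a == h a)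
    (enum {: tup A n}).
- by exists (proj A i0); apply: mem_proj.
- by move=> a; have [f fG fa] := base a; exists f => //; apply/eqP.
- move=> f g a b fG gG /eqP fb /eqP ga.
  have [k kG [ka kb kc]] := step a b f g fG gG fb ga; exists k => //.
  by split=> [||c /eqP fc /eqP gc]; apply/eqP; auto.
suff -> : h = f by [].
by apply/ffunP => a; apply/esym/eqP/(allP fh); rewrite mem_enum.
Qed.

(** The permutation witnessing R respects projections, so it sends [a i] to [b i], and it sends
    [h a] to [h b]. *)
Lemma Rrel_proj (A : finType) (F : opset A) n (a b : tup A n) (h : op A n) :
  is_clone F -> conservative_ops F -> Rrel F a b -> h \in F n ->
  exists i, h a = a i /\ h b = b i.
Proof.
move=> cloneF consF /existsP[s /forall_inP sP] hF.
have [i hi] := op_entry consF a hF; exists i; split=> //.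
have /eqP := sP _ (mem_proj cloneF i); rewrite !ffunE => ->.
by rewrite -hi; apply/eqP/sP.
Qed.

Section Majority.
Variables (A : finType) (F G : opset A) (m : op A 3).
Hypotheses (cloneF : is_clone F) (consF : conservative_ops F).
Hypotheses (cloneG : is_clone G) (symG : symmetric_ops G) (consG : conservative_ops G).
Hypotheses (mG : m \in G 3) (mP : is_majority m).
Hypothesis eqR : forall n (a b : tup A n), Rrel F a b = Rrel G a b.
Hypothesis eqD : forall n (a b : tup A n), Drel F a b = Drel G a b.

(** R transfers the graph case and conservativity settles the full product. A cross for [G] gives D,
    hence a cross covering the values of [F]; it remains to compare the centres. *)
Lemma attained_of_majority n (a b : tup A n) h : h \in F n -> attained G a b (h a) (h b).
Proof.
move=> hF.
have tv c := @majority_third_value _ _ _ n c cloneG symG consG mG mP.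
have [Rab|full|[x0 [y0 [row col cross [w wx wy] [v vx vy]]]]] :=
  Rrel_full_or_cross cloneG consG (tv a) (tv b).
- rewrite -eqR in Rab; have [i [-> ->]] := Rrel_proj cloneF consF Rab hF.
  exact: attained_proj.
- by have [[i ->] [j ->]] := (op_entry consF a hF, op_entry consF b hF).
have : Drel F a b.
  rewrite eqD; apply/existsP; exists x0; apply/existsP; exists y0.
  by apply/forall_inP => f /cross[] ->; rewrite eqxx ?orbT.
move=> /existsP[x1 /existsP[y1 /forall_inP cross1]].
have crossF i : a i = x1 \/ b i = y1.
  by have := cross1 _ (mem_proj cloneF i); rewrite !ffunE => /orP[] /eqP; [left|right].
have crossG i : a i = x0 \/ b i = y0.
  by have := cross _ (mem_proj cloneG i); rewrite !ffunE.
(* If the centres differ in one coordinate only, the index [w] or [v] on an arm violates the cover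
   for [F]. *)
have [x01|x01] := eqVneq x1 x0; have [y01|y01] := eqVneq y1 y0.
- have [j hb] := op_entry consF b hF; have [i ha] := op_entry consF a hF.
  by case/orP: (cross1 h hF) => /eqP ->; rewrite ?x01 ?y01 ?hb ?ha.
- case: (crossF w) => wE; first by rewrite wE x01 eqxx in wx.
  by rewrite -wy wE eqxx in y01.
- case: (crossF v) => vE; first by rewrite -vx vE eqxx in x01.
  by rewrite vE y01 eqxx in vy.
have av1 : b v = y1 by case: (crossF v) => // vE; rewrite -vx vE eqxx in x01.
have aw1 : a w = x1 by case: (crossF w) => // wE; rewrite -wy wE eqxx in y01.
(* With both coordinates different, only [(x0, y1)] and [(x1, y0)] occur as joint entries. The
   centre [(x0, y0)] is attained, hence so is [(x1, y1)], which lies off the cross. *)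
have ab i : a i = x0 /\ b i = y1 \/ a i = x1 /\ b i = y0.
  case: (crossF i) => iF; case: (crossG i) => iG; [|by right|by left|].
    by rewrite -iF iG eqxx in x01.
  by rewrite -iF iG eqxx in y01.
have : attained G a b x1 y1.
  apply: (@two_valued_graph _ _ cloneG symG consG _ _ _ x0 x1 y0 y1 w v) => //.
  - by rewrite eq_sym.
  - by rewrite eq_sym.
  - by rewrite -wy; apply: row.
case/attainedP => f fG [fa fb]; case: (cross f fG) => fE.
  by rewrite -fa fE eqxx in x01.
by rewrite -fb fE eqxx in y01.
Qed.

Lemma majority_subset n : A -> {subset F n <= G n}.
Proof.
(* Conservativity at a constant tuple yields an index, so [n] is positive. *)
move=> x0 h hF; have [i _] := op_entry consF [ffun=> x0] hF.
apply: interpolation_clone => // [a b f g fG gG fb ga|a].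
  have /attainedP[k kG [ka kb]] := attained_of_majority a b hF.
  have [l lG lE] := mem_comp3 cloneG mG fG gG kG; exists l => //; split=> [||c fc gc].
  - by rewrite lE ga ka; have [] := mP (h a) (f a).
  - by rewrite lE fb kb; have [] := mP (h b) (g b).
  - by rewrite lE fc gc; have [] := mP (h c) (k c).
have [j ->] := op_entry consF a hF; exists (proj A j); last by rewrite ffunE.
exact: mem_proj.
Qed.

End Majority.

(** * Semiprojections and tuples with many values *)

Lemma ex_third_entry (A : finType) n (a : tup A n) x y :
  2 < #|codom a| -> exists i, a i != x /\ a i != y.
Proof.
move=> a3; have [/existsP[i /andP[]]|none] := boolP [exists i, (a i != x) && (a i != y)].
  by exists i.
suff /subset_leq_card : codom a \subset [set x; y].
  by rewrite cards2 => /(leq_trans a3); case: (x != y).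
apply/subsetP => _ /codomP[i ->]; rewrite !inE; apply: contraNT none => axy.
by apply/existsP; exists i; rewrite -negb_or.
Qed.

Lemma ex_third_ord k (i j : 'I_k) : 2 < k -> exists l, l != i /\ l != j.
Proof.
move=> k3; have := @ex_third_entry _ k [ffun l => l] i j.
have inj : injective ([ffun l => l] : tup 'I_k k) by move=> p q; rewrite !ffunE.
by rewrite card_codom // card_ord => /(_ k3)[l]; rewrite ffunE; exists l.
Qed.

Lemma prescribe_entry (A : finType) k (C : {pred A}) (z : tup A k) i w :
  injective z -> (forall l, z l \in C) -> w \in C ->
  exists z' : tup A k, [/\ injective z', forall l, z' l \in C, z' i = w &
    forall l, l != i -> z l != w -> z' l = z l].
Proof.
move=> zI zC wC; exists [ffun l => tperm (z i) w (z l)]; split.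
- by move=> p q; rewrite !ffunE => /perm_inj/zI.
- by move=> l; rewrite ffunE; case: tpermP.
- by rewrite ffunE tpermL.
- by move=> l li zlw; rewrite ffunE tpermD // eq_sym // (inj_eq zI).
Qed.

(** Enumerate [k] values of [b] and install the three prescribed ones by transpositions; as they are
    distinct, no later transposition undoes an earlier one. *)
Lemma ex_injective_tuple (A : finType) n (b : tup A n) k (i j l : 'I_k) x y t :
  k <= #|codom b| -> i != j -> l != i -> l != j -> x != y -> x != t -> y != t ->
  x \in codom b -> y \in codom b -> t \in codom b ->
  exists z : tup A k, [/\ injective z, forall p, z p \in codom b, z i = x, z j = y & z l = t].
Proof.
move=> kb ij li lj xy xt yt xb yb tb.
pose z0 : tup A k := [ffun p => enum_val (widen_ord kb p)].
have z0I : injective z0 by move=> p q; rewrite !ffunE => /enum_val_inj/(congr1 val)/= /val_inj.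
have z0b p : z0 p \in codom b by rewrite ffunE enum_valP.
have [z1 [z1I z1b z1i _]] := prescribe_entry i z0I z0b xb.
have [z2 [z2I z2b z2j z2E]] := prescribe_entry j z1I z1b yb.
have [z3 [z3I z3b z3l z3E]] := prescribe_entry l z2I z2b tb.
have z2i : z2 i = x by rewrite z2E // z1i.
exists z3; split=> //; first by rewrite z3E ?z2i // eq_sym.
by rewrite z3E ?z2j // eq_sym.
Qed.

Section Semiprojection.
Variables (A : finType) (G : opset A) (k : nat) (i : 'I_k) (s : op A k).
Hypotheses (cloneG : is_clone G) (symG : symmetric_ops G) (consG : conservative_ops G).
Hypotheses (k_gt2 : 2 < k) (sG : s \in G k) (sP : is_proper_semiprojection i s).

(** A tuple where [s] leaves its projection is injective, so conjugation moves it onto any injective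
    [z]; the selected position [j] stays the same. *)
Lemma semiprojection_moves : exists2 j, j != i & forall z : tup A k, injective z ->
  exists2 s', s' \in G k & s' z = z j /\
    forall (b : tup A k) p q, p != q -> b p = b q -> s' b = b i.
Proof.
have [sproj [a0 a0P]] := sP; have [j a0j] := op_entry consG a0 sG.
have a0I : injective a0.
  by move=> p q a0pq; apply/eqP; apply: contra_notT a0P => /sproj ->.
exists j => [|z zI]; first by apply: contra_notN a0P => /eqP <-.
have [|t tP] := @exists_perm_extending A _ (enum 'I_k) z a0.
  by move=> p q _ _; rewrite (inj_eq zI) (inj_eq a0I).
have tE p : t (z p) = a0 p by rewrite tP ?mem_enum.
have [s' s'G s'E] := mem_conj symG t sG; exists s' => //; split=> [|b p q pq bpq].
  apply: (@perm_inj _ t); rewrite s'E tE -a0j; congr (s _).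
  by apply/ffunP => p; rewrite ffunE tE.
by apply: (@perm_inj _ t); rewrite s'E (sproj _ p q) // !ffunE // bpq.
Qed.

(** Insert [f1], [f2], [f3] at positions [i], [j], [l] and projections elsewhere, so that the inner
    tuple at [b] is injective and position [j] is selected. Any repetition in the inner tuple at [a]
    returns [f1 a]. *)
Lemma semiprojection_combine n (b : tup A n) f1 f2 f3 :
  f1 \in G n -> f2 \in G n -> f3 \in G n -> k <= #|codom b| ->
  f1 b != f2 b -> f1 b != f3 b -> f2 b != f3 b ->
  exists2 f, f \in G n & f b = f2 b /\
    forall a, [|| f1 a == f2 a, f1 a == f3 a, f2 a == f3 a | #|codom a| < k] -> f a = f1 a.
Proof.
move=> f1G f2G f3G kb b12 b13 b23.
have [j ji sj] := semiprojection_moves; have [l [li lj]] := ex_third_ord i j k_gt2.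
have [||||||||||z [zI zb zi zj zl]] := @ex_injective_tuple _ _ b k i j l (f1 b) (f2 b) (f3 b);
  rewrite // 1?eq_sym ?consG //.
have [q qE] : exists q : 'I_k -> 'I_n, forall p, z p = b (q p).
  by apply: (@fin_all_exists _ _ (fun p q => z p = b q)) => p; apply/codomP.
have [s' s'G [s'z s'P]] := sj z zI.
pose gs p := if p == i then f1 else if p == j then f2 else if p == l then f3 else proj A (q p).
have [|f fG fE] := mem_comp cloneG (gs := gs) s'G.
  by move=> p; rewrite /gs; do 3!case: ifP => // _; apply: mem_proj.
have gsi a : ([ffun p => gs p a] : tup A k) i = f1 a by rewrite ffunE /gs eqxx.
have gsj a : ([ffun p => gs p a] : tup A k) j = f2 a by rewrite ffunE /gs (negPf ji) eqxx.
have gsl a : ([ffun p => gs p a] : tup A k) l = f3 a.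
  by rewrite ffunE /gs (negPf li) (negPf lj) eqxx.
exists f => //; split=> [|a].
  rewrite fE -zj -s'z; congr (s' _); apply/ffunP => p; rewrite ffunE /gs.
  have [->//|_] := eqVneq p i; have [->//|_] := eqVneq p j; have [->//|_] := eqVneq p l.
  by rewrite ffunE -qE.
rewrite fE -[in RHS]gsi => /or4P[/eqP e|/eqP e|/eqP e|small].
- by apply: (s'P _ i j); rewrite 1?eq_sym // gsi gsj.
- by apply: (s'P _ i l); rewrite 1?eq_sym // gsi gsl.
- by apply: (s'P _ j l); rewrite 1?eq_sym // gsj gsl.
(* Pigeonhole: the [k] inner values lie in the range of [a]. *)
have /injectivePn[p [p' pp' e]] : ~~ injectiveb ([ffun p => gs p a] : tup A k).
  apply: contraL small => /injectiveP/card_codom; rewrite card_ord -leqNgt => <-.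
  apply/subset_leq_card/subsetP => _ /codomP[p ->]; rewrite ffunE /gs.
  by do 3!(case: ifP => _; first exact: consG); rewrite ffunE codom_f.
exact: s'P pp' e.
Qed.

Lemma semiprojection_third_value n (b : tup A n) :
  k <= #|codom b| -> third_value_property G b.
Proof.
move=> kb f1 f2 f3 f1G f2G f3G b12 b13 b23.
have [f fG [fb fE]] := semiprojection_combine f1G f2G f3G kb b12 b13 b23.
by exists f => //; split=> // a /eqP a13; apply: fE; rewrite a13 orbT.
Qed.

(** A cross would miss some member: combine the coordinates [v], [w] on its arms with an [f3] that
    has value [y] at [b] and a third value at [a]. The result has values [a w] and [b v]. *)
Lemma Rrel_or_full n (a b : tup A n) : k <= #|codom a| -> k <= #|codom b| ->
  Rrel G a b \/ forall p q, attained G a b (a p) (b q).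
Proof.
move=> ka kb.
have [|?|[x [y [_ col cross [w wx wy] [v vx vy]]]]] := Rrel_full_or_cross cloneG consG
  (semiprojection_third_value ka) (semiprojection_third_value kb); [by left|by right|].
have [q [qx qw]] := ex_third_entry x (a w) (leq_trans k_gt2 ka).
have /attainedP[f3 f3G [f3a f3b]] := col q.
have [|||f fG [fa fE]] := semiprojection_combine (mem_proj cloneG v) (mem_proj cloneG w) f3G ka.
- by rewrite !ffunE vx eq_sym.
- by rewrite ffunE vx f3a eq_sym.
- by rewrite ffunE f3a eq_sym.
case: (cross f fG) => [fx|fy].
  by rewrite -fx fa ffunE eqxx in wx.
have fb : f b = b v by rewrite fE !ffunE // wy f3b eqxx !orbT.
by rewrite -fb fy eqxx in vy.
Qed.

Section Inclusion.
Variable F : opset A.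
Hypotheses (cloneF : is_clone F) (consF : conservative_ops F).
Hypothesis eqR : forall n (a b : tup A n), Rrel F a b = Rrel G a b.

Lemma semiprojection_subset n (h g0 : op A n) : h \in F n -> g0 \in G n ->
  (forall a : tup A n, #|codom a| < k -> g0 a = h a) -> h \in G n.
Proof.
move=> hF g0G g0h.
have pair (a b : tup A n) : k <= #|codom a| -> k <= #|codom b| ->
    exists2 f, f \in G n & f a = h a /\ f b = h b.
  move=> ka kb; apply/attainedP; case: (Rrel_or_full ka kb) => [Rab|full].
    rewrite -eqR in Rab; have [p [-> ->]] := Rrel_proj cloneF consF Rab hF.
    exact: attained_proj.
  by have [[p ->] [q ->]] := (op_entry consF a hF, op_entry consF b hF).
pose low (a : tup A n) := #|codom a| < k.
(* The position [None] bundles all tuples with fewer than [k] values; at [Some a] only the other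
   tuples impose a condition. *)
pose ag (f : op A n) (o : option (tup A n)) :=
  if o is Some a then low a || (f a == h a) else [forall a, low a ==> (f a == h a)].
(* This corrects [f1] at [a] by the value of [f2], with the help of any [f3] having a third value
   there. *)
have step f1 f2 f3 a : f1 \in G n -> f2 \in G n -> f3 \in G n ->
    ~~ low a -> f1 a != h a -> f2 a = h a -> f3 a != f1 a -> f3 a != h a ->
    exists2 f, f \in G n & [/\ f a = h a, (forall b, f1 b = f3 b -> f b = f1 b),
       (forall b, low b -> f b = f1 b) & forall o, ag f1 o -> ag f2 o -> ag f o].
  move=> f1G f2G f3G; rewrite /low -leqNgt => ka f1a f2a f31 f3a.
  have [|||f fG [fa fE]] := semiprojection_combine f1G f2G f3G ka; rewrite ?f2a //.
  - by rewrite eq_sym.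
  - by rewrite eq_sym.
  exists f => //; split.
  - by rewrite fa.
  - by move=> b f13; apply: fE; rewrite f13 eqxx orbT.
  - by move=> b lb; apply: fE; rewrite [_ < k]lb !orbT.
  - case=> [b|] /=.
      by have [//|_] := boolP (low b); move=> /= /eqP f1b /eqP f2b; rewrite fE f1b ?f2b ?eqxx.
    move=> /forallP ag1 _; apply/forallP => b; apply/implyP => lb.
    by rewrite fE; [apply: (implyP (ag1 b))|rewrite [_ < k]lb !orbT].
have third x y a : ~~ low a -> exists2 f, f \in G n & f a != x /\ f a != y.
  rewrite /low -leqNgt => ka; have [q qxy] := ex_third_entry x y (leq_trans k_gt2 ka).
  by exists (proj A q); [apply: mem_proj|rewrite ffunE].
have [|||f fG fh] := @interpolation _ _ (fun f => f \in G n) ag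
    (None :: map some (enum {: tup A n})).
- by exists g0.
- case=> [a|].
    have [p hp] := op_entry consF a hF; exists (proj A p); first exact: mem_proj.
    by rewrite /ag ffunE hp eqxx orbT.
  by exists g0 => //; apply/forallP => a; apply/implyP => la; rewrite g0h.
- move=> f1 f2 o1 o2 f1G f2G ag1 ag2.
  have [ag11|nag1] := boolP (ag f1 o1); first by exists f1.
  have [ag22|nag2] := boolP (ag f2 o2); first by exists f2.
  case: o1 ag2 nag1 => [a|] ag2 nag1; last first.
    case: o2 ag1 nag2 => [b|] ag1 nag2; last by rewrite ag1 in nag1.
    move: nag2 ag1; rewrite /= negb_or => /andP[hb f2b]; rewrite (negPf hb) /= => /eqP f1b.
    have [f3 f3G [f31 f3h]] := third (f2 b) (h b) b hb.
    have [f fG [fb _ flow fall]] := step f2 f1 f3 b f2G f1G f3G hb f2b f1b f31 f3h.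
    exists f => //; split; [|exact/eqP|by move=> o ag1 ag2'; apply: fall].
    apply/forallP => c; apply/implyP => lc; rewrite flow //.
    exact: (implyP (forallP ag2 c)).
  move: nag1 ag2; rewrite /= negb_or => /andP[ha f1a]; rewrite (negPf ha) /= => /eqP f2a.
  case: o2 ag1 nag2 => [b|] ag1 nag2; last first.
    have [f3 f3G [f31 f3h]] := third (f1 a) (h a) a ha.
    have [f fG [fa _ flow fall]] := step f1 f2 f3 a f1G f2G f3G ha f1a f2a f31 f3h.
    exists f => //; split; [exact/eqP| |exact: fall].
    apply/forallP => c; apply/implyP => lc; rewrite flow //.
    exact: (implyP (forallP ag1 c)).
  move: nag2 ag1; rewrite /= negb_or => /andP[hb f2b]; rewrite (negPf hb) /= => /eqP f1b.
  have ka : k <= #|codom a| by rewrite leqNgt.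
  have kb : k <= #|codom b| by rewrite leqNgt.
  have [e eG [ea eb]] := pair a b ka kb.
  have [g gG [g1 g2]] := third (f1 a) (h a) a ha.
  have [p gp] := op_entry consG a gG.
  (* The row of [h b] has two points, from [f1] and [e], so it is full. Hence [f3] can take a third
     value at [a] while equal to [f1] at [b], and the correction at [a] preserves [h b]. *)
  have /attainedP[f3 f3G [f3b f3a]] : attained G b a (h b) (a p).
    apply: (attained_row cloneG _ (semiprojection_third_value ka) _ _ f1a).
      by apply/attainedP; exists f1.
    by apply/attainedP; exists e.
  rewrite -gp in f3a.
  have [||f fG [fa f13 _ fall]] := step f1 f2 f3 a f1G f2G f3G ha f1a f2a; rewrite ?f3a //.
  exists f => //; split=> //; apply/eqP => //.
  by rewrite f13 f1b ?f3b.
suff -> : h = f by [].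
apply/ffunP => a; apply/esym/eqP; have /= /andP[fN fS] := fh.
have [la|la] := boolP (low a); first exact: (implyP (forallP fN a)).
have := allP fS (Some a); rewrite /= (negPf la); apply.
by apply: map_f; rewrite mem_enum.
Qed.

End Inclusion.
End Semiprojection.

(** * Majorities and semiprojections from operations of minimal arity *)

Lemma ex_notin (T : finType) (s : seq T) : size s < #|T| -> exists x, x \notin s.
Proof.
move=> sT; apply/existsP; apply: contraLR sT => /existsPn all_s.
rewrite -leqNgt; apply: leq_trans (card_size s).
by apply/subset_leq_card/subsetP => x _; have := all_s x; rewrite negbK.
Qed.

Lemma nonproj_neq (A : finType) n (f : op A n) i : f != proj A i -> exists a, f a <> a i.
Proof.
have [/existsP[a /eqP]|/existsPn all_i] := boolP [exists a, f a != a i]; first by exists a.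
by case/eqP; apply/ffunP => a; rewrite ffunE; apply/eqP; have := all_i a; rewrite negbK.
Qed.

Section MinimalArity.
Variables (A : finType) (G : opset A).
Hypotheses (cloneG : is_clone G) (symG : symmetric_ops G) (consG : conservative_ops G).

(** On each pair [f] is a projection, and both kinds occur. The operation [f(f(p,q), f(r,p))]
    returns [p] on repeated entries, but not at [(x, y, z)] when [f] is the second projection on
    [x, y] and the first on [x, z]. *)
Lemma semiprojection_of_binary (f : op A 2) :
  binary_ops_locally_trivial G -> f \in G 2 -> (forall i, f != proj A i) ->
  exists2 s, s \in G 3 & is_proper_semiprojection ord0 s.
Proof.
move=> triv fG nproj.
have fE x y : f (t2 x y) = x /\ f (t2 y x) = y \/ f (t2 x y) = y /\ f (t2 y x) = x.
  have [->|xy] := eqVneq x y; first by left; rewrite (op2_idem consG).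
  have := triv f x y fG xy.
  by case: (op2_entry consG x y fG) => ->; case: (op2_entry consG y x fG) => ->; auto.
have f2 x y : f (t2 x y) = y -> f (t2 y x) = x.
  by move=> fxy; case: (fE x y) => -[] //; rewrite fxy => ->.
have f1 x y : f (t2 x y) = x -> f (t2 y x) = y.
  by move=> fxy; case: (fE x y) => -[] //; rewrite fxy => ->.
have [[a /eqP fa] [b /eqP fb]] := (nonproj_neq (nproj ord_max), nonproj_neq (nproj ord0)).
have {fa} [u [v [uv fuv]]] : exists u v, u != v /\ f (t2 u v) = u.
  exists (a ord0), (a ord_max); rewrite -(t2P (erefl (a ord0)) (erefl _)).
  have aE := t2P (erefl (a ord0)) (erefl (a ord_max)).
  case: (op2_entry consG (a ord0) (a ord_max) fG); rewrite -aE => e; last by rewrite e eqxx in fa.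
  by split=> //; rewrite -e.
have {fb} [u' [v' [uv' fuv']]] : exists u v, u != v /\ f (t2 u v) = v.
  have bE := t2P (erefl (b ord0)) (erefl (b ord_max)).
  exists (b ord0), (b ord_max); rewrite -bE.
  case: (op2_entry consG (b ord0) (b ord_max) fG); rewrite -bE => e; first by rewrite e eqxx in fb.
  by split=> //; rewrite -e eq_sym.
(* If [u] and [u'] differ, their pair has one of the two kinds and shares an element with the given
   pair of the other kind. *)
have [x [y [z [xy xz fxy fxz]]]] : exists x y z,
    [/\ x != y, x != z, f (t2 x y) = y & f (t2 x z) = x].
  have [uu|uu] := eqVneq u u'; first by exists u, v', v; split; rewrite // uu.
  case: (op2_entry consG u u' fG) => fuu.
    by exists u', v', u; split; rewrite // 1?eq_sym //; apply: f1.
  by exists u, u', v.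
have [P0 [P1 P2]] : proj A (ord0 : 'I_3) \in G 3 /\ proj A (inord 1 : 'I_3) \in G 3
  /\ proj A (ord_max : 'I_3) \in G 3 by rewrite !mem_proj.
have [g gG gE] := mem_comp2 cloneG fG P0 P1.
have [g' g'G g'E] := mem_comp2 cloneG fG P2 P0.
have [s sG sE] := mem_comp2 cloneG fG gG g'G; exists s => //.
have sE3 p q r : s (t3 p q r) = f (t2 (f (t2 p q)) (f (t2 r p))).
  by rewrite sE gE g'E !(ffunE _ (t3 _ _ _)) t3_0 t3_1 t3_2.
have I := op2_idem consG _ fG.
split=> [c p q pq cpq|].
  have [d [e [->|->|->]]] := repeated_entry3 pq cpq; rewrite sE3 t3_0 ?I.
  - by case: (op2_entry consG e d fG) => fed; rewrite fed ?I //; apply: f1.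
  - by case: (op2_entry consG d e fG) => fde; rewrite fde ?I //; apply: f2.
  - by case: (fE d e) => -[de ed]; rewrite !(de, ed).
exists (t3 x y z); rewrite sE3 t3_0 fxy (f1 _ _ fxz).
by case: (op2_entry consG y z fG) => -> /esym/eqP; rewrite ?(negPf xy) ?(negPf xz).
Qed.

(** Identifying two coordinates lowers the arity below [r], where every member is a projection. *)
Lemma identified_op r (f : op A r) (p q : 'I_r) :
  small_ops_trivial G r -> f \in G r -> p != q ->
  exists j, forall a : tup A r, a p = a q -> f a = a j.
Proof.
case: r f p q => [|r] f p q triv fG; first by case: p.
rewrite eq_sym => /unlift_some[p' pE _].
pose phi l := if unlift q l is Some l' then l' else p'.
have [g gG gE] := mem_minor cloneG phi fG; have [j gj] := triv r g (ltnSn r) gG.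
exists (lift q j) => a apq.
have := gE [ffun l => a (lift q l)]; rewrite gj !ffunE => ->; congr (f _).
apply/ffunP => l; rewrite !ffunE /phi; case: unliftP => [l' ->//|->].
by rewrite -pE apq.
Qed.

(* Swierczkowski's lemma *)
Lemma semiprojection_of_large_arity r (f : op A r) u v : u != v :> A -> 3 < r ->
  small_ops_trivial G r -> f \in G r -> (forall i, f != proj A i) ->
  exists i, is_proper_semiprojection i f.
Proof.
move=> uv r4 triv fG nproj.
have idf p q (pq : p != q) := identified_op triv fG pq.
have ex_other (s : seq 'I_r) : size s < 4 -> exists x, x \notin s.
  by move=> s4; apply: ex_notin; rewrite card_ord; apply: leq_trans r4.
(* These two-valued tuples detect which coordinate is selected. *)
pose ind (s : seq 'I_r) : tup A r := [ffun l => if l \in s then u else v].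
have indE s l : ind s l = if l \in s then u else v by rewrite ffunE.
have ind_in s l : ind s l = u -> l \in s.
  by rewrite indE; case: ifP => // _ e; rewrite e eqxx in uv.
have indT s l : l \in s -> ind s l = u by rewrite indE => ->.
have indN s l : l \notin s -> ind s l = v by rewrite indE => /negPf->.
(* One identified pair selecting a coordinate [i] outside it forces the value [a i] for every
   identification: first for pairs avoiding [i], then, using two further coordinates, for pairs
   containing it. *)
have crit i p q : p != q -> p != i -> q != i -> (forall a : tup A r, a p = a q -> f a = a i) ->
    is_proper_semiprojection i f.
  move=> pq pi qi fpq.
  have away p' q' : p' != q' -> p' != i -> q' != i ->
      forall a : tup A r, a p' = a q' -> f a = a i.
    move=> pq' pi' qi'; have [j fj] := idf p' q' pq'.
    suff : j \in [:: i] by rewrite inE => /eqP <-.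
    apply: ind_in; rewrite -fj; last by rewrite !indN ?inE.
    by rewrite fpq; [rewrite indT ?inE|rewrite !indN ?inE].
  have near q' : i != q' -> forall a : tup A r, a i = a q' -> f a = a i.
    move=> iq a aiq; have [j fj] := idf i q' iq.
    have [->|ji] := eqVneq i j; first exact: fj.
    have [jq|jq] := eqVneq j q'; first by rewrite fj // jq.
    have [x] := ex_other [:: i; q'] isT; rewrite !inE negb_or => /andP[xi xq].
    have [y] := ex_other [:: i; q'; x] isT; rewrite !inE !negb_or => /and3P[yi yq yx].
    have xy : x != y by rewrite eq_sym.
    have : j \in [:: i; q'].
      apply: ind_in; rewrite -fj; last by rewrite !indT ?inE ?eqxx ?orbT.
      rewrite (away x y) //; first by rewrite indT ?inE ?eqxx.
      by rewrite !indN // !inE negb_or ?xi ?yi.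
    by rewrite !inE (negPf jq) eq_sym (negPf ji).
  split=> [a p' q' pq' apq|].
    have [pi'|pi'] := eqVneq p' i; first by rewrite pi' in pq' apq; apply: near pq' _ _.
    have [qi'|qi'] := eqVneq q' i; last exact: away pq' _ _ _ _.
    by rewrite qi' in pq' apq; apply: (near p'); rewrite // eq_sym.
  exact: nonproj_neq (nproj i).
have [x0 _] := ex_other [::] isT.
have [x1] := ex_other [:: x0] isT; rewrite !inE => x10.
have [x2] := ex_other [:: x0; x1] isT; rewrite !inE negb_or => /andP[x20 x21].
have [x3] := ex_other [:: x0; x1; x2] isT; rewrite !inE !negb_or => /and3P[x30 x31 x32].
(* Two disjoint pairs cannot both select inside themselves: the tuple with [u] on the first pair and
   [v] elsewhere would receive both values. *)
have [i fi] := idf x1 x0 x10; have [j fj] := idf x3 x2 x32.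
have [ei|i1] := boolP (i \in [:: x0; x1]); last first.
  move: i1; rewrite !inE negb_or => /andP[i0 i1].
  by exists i; apply: (crit i x1 x0) => //; rewrite eq_sym.
have [ej|j1] := boolP (j \in [:: x2; x3]); last first.
  move: j1; rewrite !inE negb_or => /andP[j2 j3].
  by exists j; apply: (crit j x3 x2) => //; rewrite eq_sym.
have : j \in [:: x0; x1].
  apply: ind_in; rewrite -fj; last by rewrite !indN // !inE negb_or ?x20 ?x30.
  rewrite fi; first by rewrite indT.
  by rewrite !indT // !inE ?eqxx ?orbT.
move: ej; rewrite !inE => /orP[] /eqP ->.
  by rewrite (negPf x20) (negPf x21).
by rewrite (negPf x30) (negPf x31).
Qed.

End MinimalArity.

Section Ternary.
Variables (A : finType) (G : opset A).
Hypotheses (cloneG : is_clone G) (consG : conservative_ops G).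

Lemma semiprojection3 (s : op A 3) (i : 'I_3) :
  (forall x y, [/\ s (t3 x x y) = t3 x x y i, s (t3 x y x) = t3 x y x i
                 & s (t3 y x x) = t3 y x x i]) ->
  (exists a, s a <> a i) -> is_proper_semiprojection i s.
Proof.
move=> sE nproj; split=> // a p q pq apq.
have [x [y]] := repeated_entry3 pq apq; have [s1 s2 s3] := sE x y.
by case=> ->.
Qed.

(** Each of the three identifications returns the repeated or the odd entry. Never odd: a majority.
    Once odd: a semiprojection. Twice odd: a Pixley operation up to the order of variables, and
    substituting [f] into itself gives a majority. Always odd: a minority. *)
Lemma majority_or_semiprojection (f : op A 3) :
  2 < #|A| -> small_ops_trivial G 3 -> f \in G 3 -> (forall i, f != proj A i) ->
  (exists2 m, m \in G 3 & is_majority m) \/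
  exists i, exists2 s, s \in G 3 & is_proper_semiprojection i s.
Proof.
move=> A3 triv fG nproj.
have nprojE i := nonproj_neq (nproj i).
have semi i : (forall x y, [/\ f (t3 x x y) = t3 x x y i, f (t3 x y x) = t3 x y x i
    & f (t3 y x x) = t3 y x x i]) -> exists i, exists2 s, s \in G 3 & is_proper_semiprojection i s.
  by move=> fi; exists i, f => //; apply: semiprojection3.
have idf p q (pq : p != q) := identified_op cloneG triv fG pq.
have f3 : (forall x y, f (t3 x x y) = x) \/ (forall x y, f (t3 x x y) = y).
  have [|j fj] := idf ord0 (inord 1); first by rewrite -val_eqE /= inordK.
  have [ej|ej|ej] := ord3E j; [left|left|right] => x y; rewrite fj ?ej ?t3_0 ?t3_1 ?t3_2 //.
have f2 : (forall x y, f (t3 x y x) = x) \/ (forall x y, f (t3 x y x) = y).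
  have [|j fj] := idf ord0 ord_max => //.
  have [ej|ej|ej] := ord3E j; [left|right|left] => x y; rewrite fj ?ej ?t3_0 ?t3_1 ?t3_2 //.
have f1 : (forall x y, f (t3 y x x) = x) \/ (forall x y, f (t3 y x x) = y).
  have [|j fj] := idf ord_max (inord 1); first by rewrite -val_eqE /= inordK.
  have [ej|ej|ej] := ord3E j; [right|left|left] => x y; rewrite fj ?ej ?t3_0 ?t3_1 ?t3_2 //.
have [P0 [P1 P2]] : proj A (ord0 : 'I_3) \in G 3 /\ proj A (inord 1 : 'I_3) \in G 3
  /\ proj A (ord_max : 'I_3) \in G 3 by rewrite !mem_proj.
have [g0 g0G g0E] := mem_comp3 cloneG fG fG P1 P2.
have [g1 g1G g1E] := mem_comp3 cloneG fG P0 fG P2.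
have [g2 g2G g2E] := mem_comp3 cloneG fG P0 P1 fG.
have E0 x y z : g0 (t3 x y z) = f (t3 (f (t3 x y z)) y z).
  by rewrite g0E !(ffunE _ (t3 _ _ _)) t3_1 t3_2.
have E1 x y z : g1 (t3 x y z) = f (t3 x (f (t3 x y z)) z).
  by rewrite g1E !(ffunE _ (t3 _ _ _)) t3_0 t3_2.
have E2 x y z : g2 (t3 x y z) = f (t3 x y (f (t3 x y z))).
  by rewrite g2E !(ffunE _ (t3 _ _ _)) t3_0 t3_1.
case: f1 => f1; case: f2 => f2; case: f3 => f3.
- by left; exists f.
- by right; apply: (semi ord_max) => x y; rewrite !t3_2 f1 f2 f3.
- by right; apply: (semi (inord 1)) => x y; rewrite !t3_1 f1 f2 f3.
- left; exists g0 => // x y; rewrite !E0; split; rewrite !(f1, f2, f3) //.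
- by right; apply: (semi ord0) => x y; rewrite !t3_0 f1 f2 f3.
- left; exists g1 => // x y; rewrite !E1; split; rewrite !(f1, f2, f3) //.
- left; exists g2 => // x y; rewrite !E2; split; rewrite !(f1, f2, f3) //.
(* [f] is a minority operation, so [g0] and [g1] are projections on repeated entries. *)
have [x _] : exists x : A, x \notin [::] by apply: ex_notin; apply: ltn_trans A3.
have [y] : exists y : A, y \notin [:: x] by apply: ex_notin; apply: ltn_trans A3.
rewrite !inE => yx.
have [z] : exists z : A, z \notin [:: x; y] by apply: ex_notin.
rewrite !inE negb_or => /andP[zx zy]; right.
(* At distinct [x], [y], [z]: if [f] returns [x], then [g1] returns [z] instead of [y]; otherwise
   [g0] returns [z] or [y] instead of [x]. *)
have [fx|fx] := eqVneq (f (t3 x y z)) x.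
  exists (inord 1), g1 => //; apply: semiprojection3 => [c d|].
    by rewrite !t3_1 !E1 !(f1, f2, f3).
  by exists (t3 x y z); rewrite E1 t3_1 fx f3; apply/eqP.
exists ord0, g0 => //; apply: semiprojection3 => [c d|].
  by rewrite !t3_0 !E0 !(f1, f2, f3).
exists (t3 x y z); rewrite E0 t3_0; apply/eqP.
case: (op3_entry consG x y z fG) => fE; rewrite fE ?f2 ?f3 // in fx *.
by rewrite eqxx in fx.
Qed.

End Ternary.

(** * Agreement on tuples with few values *)

Section LowRange.
Variables (A : finType) (F G : opset A).
Hypotheses (cloneF : is_clone F) (consF : conservative_ops F).
Hypotheses (cloneG : is_clone G) (consG : conservative_ops G).

(** Factored through the range of [a], both operations have arity below [r], so they are
    projections; their agreement on one pair forces the same coordinate. *)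
Lemma agree_below_minimal_arity r n (h g : op A n) u v :
  small_ops_trivial F r -> small_ops_trivial G r -> u != v ->
  h \in F n -> g \in G n -> agree_on [set u; v] h g ->
  forall a : tup A n, #|codom a| < r -> g a = h a.
Proof.
move=> trivF trivG uv hF gG hg a ar.
have [i0 _] := op_entry consF a hF.
pose rk i := enum_rank_in (codom_f a i0) (a i).
have rkE i : enum_val (rk i) = a i by rewrite enum_rankK_in ?codom_f.
have [h' h'F h'E] := mem_minor cloneF rk hF.
have [g' g'G g'E] := mem_minor cloneG rk gG.
have [j hj] := trivF _ h' ar h'F; have [j' gj] := trivG _ g' ar g'G.
(* With [u] at [j] alone, this tuple tells coordinate [j] from all others. *)
pose t : tup A #|codom a| := [ffun l => if l == j then u else v].
have tE : h' t = g' t.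
  by rewrite h'E g'E; apply: hg => i; rewrite !ffunE; case: ifP; rewrite !inE eqxx ?orbT.
have jj : j' = j.
  apply/eqP; move: tE; rewrite hj gj !ffunE eqxx.
  by case: eqP => // _ e; rewrite e eqxx in uv.
pose c : tup A #|codom a| := [ffun l => enum_val l].
have ca : a = [ffun i => c (rk i)] by apply/ffunP => i; rewrite !ffunE rkE.
by rewrite ca -h'E -g'E hj gj jj.
Qed.

(** On tuples over a pair, [f] acts as a binary minor, and the permutation witnessing R sends [u] to
    [u'] and [v] to [v']. *)
Lemma Rrel_pair_equivariant n (f : op A n) (a : tup A n) u v u' v' :
  u != v -> Rrel F (t2 u v) (t2 u' v') -> f \in F n -> (forall i, a i \in [set u; v]) ->
  f [ffun i => if a i == u then u' else v'] = if f a == u then u' else v'.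
Proof.
move=> uv /existsP[s /forall_inP sP] fF auv.
have su : s u = u'.
  by have /eqP := sP _ (mem_proj cloneF ord0); rewrite !ffunE => /esym; rewrite !(tnth_nth u).
have sv : s v = v'.
  by have /eqP := sP _ (mem_proj cloneF ord_max); rewrite !ffunE => /esym; rewrite !(tnth_nth u).
have [g gF gE] := mem_minor cloneF (fun i => if a i == u then ord0 else ord_max : 'I_2) fF.
have -> : [ffun i => if a i == u then u' else v'] =
    [ffun i => t2 u' v' (if a i == u then ord0 else ord_max : 'I_2)] :> tup A n.
  by apply/ffunP => i; rewrite !ffunE; case: ifP; rewrite (tnth_nth u).
have -> : f a = g (t2 u v).
  rewrite gE; congr (f _); apply/ffunP => i; rewrite [RHS]ffunE.
  have := auv i; rewrite !inE => /orP[]/eqP->; first by rewrite eqxx t2_0.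
  by rewrite eq_sym (negPf uv) t2_1.
rewrite -gE (eqP (sP g gF)).
by case: (op2_entry consF u v gF) => ->; rewrite ?eqxx // eq_sym (negPf uv).
Qed.

End LowRange.

(** * Gluing over pairs, and the inclusion of the clones *)

Section Inclusion.
Variables (A : finType) (F G : opset A).
Hypotheses (cloneF : is_clone F) (consF : conservative_ops F).
Hypotheses (cloneG : is_clone G) (symG : symmetric_ops G) (consG : conservative_ops G).
Hypothesis eqR : forall n (a b : tup A n), Rrel F a b = Rrel G a b.
Hypothesis eqD : forall n (a b : tup A n), Drel F a b = Drel G a b.
Hypothesis eqB : forall B : {set A}, #|B| = 2 -> same_restriction F G B.

(** Exchanging the arguments of a member turns a first projection on a pair into a second one, so
    the implication also holds with [u] and [u'] as values; this makes the renaming a witness for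
    R. *)
Lemma not_separated_Rrel u v u' v' : u != v -> u' != v' -> binary_ops_locally_trivial G ->
  (forall e, e \in G 2 -> e (t2 u v) = v -> e (t2 u' v') = v') ->
  Rrel G (t2 u v) (t2 u' v').
Proof.
move=> uv uv' triv imp.
have [|s sP] := @exists_perm_extending A _ [:: true; false]
    (fun b : bool => if b then u else v) (fun b : bool => if b then u' else v').
  by do 2![case]; rewrite ?eqxx // => _ _; rewrite ?(negPf uv) ?(negPf uv') // eq_sym
    ?(negPf uv) ?(negPf uv') // eq_sym (negPf uv').
apply/existsP; exists s; apply/forall_inP => e eG; apply/eqP.
case: (op2_entry consG u v eG) => euv; rewrite euv; last first.
  by rewrite (sP false) // imp.
rewrite (sP true) //; have [d dG dE] := mem_minor2 cloneG eG.
have euv' : d (t2 u v) = v.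
  rewrite dE; case: (op2_entry consG v u eG) => // evu.
  by case: (triv e u v eG uv); rewrite euv evu.
case: (op2_entry consG u' v' eG) => // e'; case: (triv e u' v' eG uv').
by rewrite e' -dE imp.
Qed.

(** Equal restrictions give agreement on single pairs, and interpolation glues them. Two pairs are
    either separated by a binary member or related by R, and then agreement on one implies agreement
    on the other. *)
Lemma ex_agree_on_pairs n (h : op A n) : A -> 1 < #|A| ->
  binary_ops_locally_trivial G -> h \in F n ->
  exists2 g, g \in G n & forall a : tup A n, #|codom a| < 3 -> g a = h a.
Proof.
move=> x0 A2 triv hF; have [i0 _] := op_entry consF [ffun=> x0] hF.
pose within (a : tup A n) (p : A * A) := [forall i, a i \in [set p.1; p.2]].
pose ag (f : op A n) p := [forall a, within a p ==> (f a == h a)].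
have agP (f : op A n) p : reflect (forall a, within a p -> f a = h a) (ag f p).
  apply: (iffP forallP) => [H a ap|H a]; first exact/eqP/(implyP (H a)).
  by apply/implyP => /H ->.
have in_pair (K : opset A) (f : op A n) a p : conservative_ops K -> f \in K n -> within a p ->
    f a \in [set p.1; p.2].
  by move=> consK fK /forallP ap; have [i ->] := op_entry consK a fK.
have ag_diag (f : op A n) u : f \in G n -> ag f (u, u).
  move=> fG; apply/agP => a au.
  have := in_pair F h a _ consF hF au; have := in_pair G f a _ consG fG au.
  by rewrite !inE !orbb => /eqP -> /eqP ->.
have base p : exists2 f, f \in G n & ag f p.
  case: p => u v; have [<-|uv] := eqVneq u v.
    by exists (proj A i0); [|apply: ag_diag]; apply: mem_proj.
  have [|/(_ h hF)[f fG fh] _] := @eqB [set u; v] _ n; first by rewrite cards2 uv.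
  by exists f => //; apply/agP => a /forallP ap; rewrite -fh.
have [||f fG fh] := @interpolation _ _ (fun f => f \in G n) ag (enum {: A * A}) _ base.
- by have [f fG _] := base (x0, x0); exists f.
- move=> f1 f2 [u v] [u' v'] f1G f2G ag1 ag2.
  have [uv|uv] := eqVneq u v.
    by rewrite -uv in ag2 *; exists f1 => //; split=> //; apply: ag_diag.
  have [uv'|uv'] := eqVneq u' v'.
    by rewrite -uv' in ag1 *; exists f2 => //; split=> //; apply: ag_diag.
  have [/existsP[e /and3P[eG /eqP euv /eqP euv']]|nosep] := boolP
      [exists e, [&& e \in G 2, e (t2 u v) == v & e (t2 u' v') == u']].
    (* Being the second projection on [u, v] and the first on [u', v'], [e] follows [f2] on one pair
       and [f1] on the other. *)
    have [k kG kE] := mem_comp2 cloneG eG f1G f2G; exists k => //; split.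
    + apply/agP => a ap; rewrite kE (agP _ _ ag2 a ap).
      have := in_pair F h a _ consF hF ap; have := in_pair G f1 a _ consG f1G ap.
      rewrite !inE => /orP[] /eqP -> /orP[] /eqP -> //=; rewrite ?(op2_idem consG) //.
      case: (op2_entry consG v u eG) => // evu.
      by case: (triv e u v eG uv); rewrite euv evu.
    + apply/agP => a ap; rewrite kE (agP _ _ ag1 a ap).
      have := in_pair F h a _ consF hF ap; have := in_pair G f2 a _ consG f2G ap.
      rewrite !inE => /orP[] /eqP -> /orP[] /eqP -> //=; rewrite ?(op2_idem consG) //.
      case: (op2_entry consG v' u' eG) => // evu.
      by case: (triv e u' v' eG uv'); rewrite euv' evu.
    + move=> p agp1 agp2; apply/agP => a ap.
      by rewrite kE (agP _ _ agp1 a ap) (agP _ _ agp2 a ap) (op2_idem consG).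
  have RG : Rrel G (t2 u v) (t2 u' v').
    apply: not_separated_Rrel => // e eG euv.
    case: (op2_entry consG u' v' eG) => // e'; case/existsP: nosep.
    by exists e; rewrite eG euv e' !eqxx.
  (* By R, both [h] and [f1] respect the renaming of the pairs, so their agreement on [u', v']
     carries back to [u, v]. *)
  exists f1 => //; split=> //; apply/agP => a ap.
  have auv i : a i \in [set u; v] by apply: (forallP ap).
  have RF : Rrel F (t2 u v) (t2 u' v') by rewrite eqR.
  have := Rrel_pair_equivariant cloneF consF uv RF hF auv.
  rewrite -(agP _ _ ag1); last first.
    by apply/forallP => i; rewrite ffunE; case: ifP; rewrite !inE eqxx ?orbT.
  rewrite (Rrel_pair_equivariant cloneG consG uv RG f1G auv).
  have := in_pair F h a _ consF hF ap; have := in_pair G f1 a _ consG f1G ap.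
  rewrite !inE => /orP[] /eqP -> /orP[] /eqP -> //=; rewrite eqxx eq_sym (negPf uv) => e.
    by rewrite e eqxx in uv'.
  by rewrite e eqxx in uv'.
exists f => // a a3; suff [p ap] : exists p, within a p.
  by apply: (agP f p) => //; apply: (allP fh); rewrite mem_enum.
have [j ja|all_eq] := pickP (fun j => a j != a i0); last first.
  exists (a i0, a i0); apply/forallP => l; rewrite !inE orbb.
  by have /negbFE := all_eq l.
exists (a i0, a j); apply/forallP => l; apply: contraLR a3; rewrite !inE negb_or => /andP[l0 lj].
rewrite -leqNgt (_ : 3 = #|[set a i0; a j; a l]|).
  by apply/subset_leq_card/subsetP => x; rewrite !inE => /orP[/orP[]|] /eqP ->; apply: codom_f.
by rewrite -setUA cardsU1 cards2 !inE negb_or eq_sym ja (eq_sym (a j)) (eq_sym (a i0)) lj l0.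
Qed.

Lemma small_ops_trivialP (K : opset A) r :
  (forall k, k < r -> ~~ has_nonproj K k) -> small_ops_trivial K r.
Proof.
move=> trivK k f /trivK /exists_inPn none /none /forallPn[i].
by rewrite negbK => /eqP; exists i.
Qed.

Lemma subset_of_invariants n : 1 < #|A| ->
  (exists r, rank_is F r /\ rank_is G r) -> {subset F n <= G n}.
Proof.
move=> A2 [r [rF rG]] h hF.
have [x _] : exists x : A, x \notin [::] by apply: ex_notin; apply: ltn_trans A2.
have [y] : exists y : A, y \notin [:: x] by apply: ex_notin.
rewrite inE eq_sym => xy.
have B2 : #|[set x; y]| = 2 by rewrite cards2 xy.
have [g gG hg] := (eqB B2 n).1 h hF.
(* If [A] has two elements, it is itself the pair on which [h] and [g] agree. *)
have [A3|] := ltnP 2 #|A|; last first.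
  rewrite leq_eqVlt ltnS [#|A| <= 1]leqNgt A2 orbF => /eqP cardA.
  suff -> : h = g by [].
  apply/ffunP => a; apply: hg => i; suff -> : [set x; y] = setT by [].
  by apply/eqP; rewrite eqEcard subsetT B2 cardsT cardA.
case: r rF rG => [r|] /=; last first.
  move=> triv _; have [i ->] := @small_ops_trivialP F n.+1 (fun k _ => triv k) n h (ltnSn n) hF.
  exact: mem_proj.
move=> [_ /small_ops_trivialP trivF] [/exists_inP[f fG /forallP fproj] /small_ops_trivialP trivG].
have of_maj : (exists2 m, m \in G 3 & is_majority m) -> h \in G n.
  by move=> [m mG mP]; apply: (majority_subset cloneF consF cloneG symG consG mG mP eqR eqD).
have of_semi k i (s : op A k) g0 : 2 < k -> s \in G k -> is_proper_semiprojection i s ->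
    g0 \in G n -> (forall a : tup A n, #|codom a| < k -> g0 a = h a) -> h \in G n.
  move=> k3 sG sP.
  exact: (semiprojection_subset cloneG symG consG k3 sG sP cloneF consF eqR hF).
have low := agree_below_minimal_arity cloneF consF cloneG trivF trivG xy hF gG hg.
case: r f fG fproj trivF trivG low => [|[|[|[|r]]]] f fG fproj trivF trivG low.
(* Conservativity excludes ranks 0 and 1: there is no entry to return, respectively only one. *)
- by have [[]] := op_entry consG [ffun=> x] fG.
- case/eqP: (fproj ord0); apply/ffunP => a; rewrite ffunE.
  by have [i ->] := op_entry consG a fG; rewrite ord1.
- have [/existsP[e /existsP[u /existsP[v /and3P[eG uv /eqP euv]]]]|nocomm] := boolP
      [exists e, exists u, exists v, [&& e \in G 2, u != v & e (t2 u v) == e (t2 v u)]].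
    exact/of_maj/(ex_majority_of_commuting_pair cloneG symG consG eG uv euv).
  have triv : binary_ops_locally_trivial G.
    move=> e u v eG uv /eqP euv; case/existsP: nocomm; exists e.
    by apply/existsP; exists u; apply/existsP; exists v; rewrite eG uv.
  have [s sG sP] := semiprojection_of_binary cloneG consG triv fG fproj.
  (* The semiprojection is ternary while the rank is 2, so [low] does not reach tuples with two
     values. *)
  have [g0 g0G g0h] := ex_agree_on_pairs x A2 triv hF.
  exact: of_semi sP g0G g0h.
- have [|[i [s sG sP]]] := majority_or_semiprojection cloneG consG A3 trivG fG fproj.
    exact: of_maj.
  exact: of_semi sP gG low.
- have [i sP] := semiprojection_of_large_arity cloneG xy (isT : 3 < r.+4) trivG fG fproj.
  exact: of_semi sP gG low.
Qed.

End Inclusion.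

Theorem theorem4 (A : finType) (F G : opset A) :
  1 < #|A| ->
  is_clone F -> is_clone G ->
  symmetric_ops F -> symmetric_ops G ->
  conservative_ops F -> conservative_ops G ->
  (exists r, rank_is F r /\ rank_is G r) ->
  (forall n (a b : tup A n), Rrel F a b = Rrel G a b) ->
  (forall n (a b : tup A n), Drel F a b = Drel G a b) ->
  (forall B : {set A}, #|B| = 2 -> same_restriction F G B) ->
  forall n, F n = G n.
Proof.
move=> A2 cloneF cloneG symF symG consF consG [r [rF rG]] eqR eqD eqB n.
(* The second inclusion exchanges [F] and [G], which swaps the two halves of [same_restriction]. *)
apply/setP => h; apply/idP/idP.
  by apply: subset_of_invariants => //; exists r.
apply: subset_of_invariants => //; last by exists r.
by move=> B /eqB BFG m; have [FG GF] := BFG m; split=> f /[dup] fK;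
  [case/GF => g gF gf|case/FG => g gF gf]; exists g => // a aB; rewrite gf.
Qed.
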